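(* Let $q>2$ be a prime power and let $\mathcal{V},\mathcal{V}'$ be two Veronese surfaces of $\mathrm{PG}(5,q)$ such that their chordal varieties are disjoint if $q$ is odd, or, if $q$ is even, $\mathcal{V}$ and $\mathcal{V}'$ have a common nuclear plane and their chordal varieties meet only in points of this plane. Then $\mathcal{V}\cup\mathcal{V}'$ is a complete cap of $\mathrm{PG}(5,q)$.
   Context: A Veronese surface of $\mathrm{PG}(5,q)$ is a projective image of the standard Veronese variety, i.e. of the set of points $\langle (x_0^2,x_1^2,x_2^2,x_0x_1,x_0x_2,x_1x_2)\rangle$, $(x_0,x_1,x_2)\ne 0$; equivalently, of the rank-$1$ points of the projective space of $3\times3$ symmetric matrices over $\mathbb{F}_q$. Its chordal variety is the corresponding image of the set of points of rank at most $2$ (zeros of the determinant). For $q$ even, the nuclear plane of a Veronese surface is the plane containing the nuclei of all its conics. A cap is a set of points no three collinear; it is complete if not contained in a larger cap. *)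

(* Defs.v *)
From HB Require Import structures.
From mathcomp Require Import all_boot all_order all_algebra.

Set Implicit Arguments.
Unset Strict Implicit.
Unset Printing Implicit Defensive.

Import GRing.Theory.
Local Open Scope ring_scope.

Section FiniteVspace.

(* vector.v keeps the subtype structure of {vspace vT} in this module. *)
Import VectorInternalTheory.

Variables (F : finFieldType) (vT : vectType F).

HB.instance Definition _ := [Countable of {vspace vT} by <:].
HB.instance Definition _ := [Finite of {vspace vT} by <:].

End FiniteVspace.

Section ProjectiveSpace.

Variable F : finFieldType.

(* The points of PG(n-1,q) are the vector subspaces of F^n of dimension 1; its
   lines and planes are the vector subspaces of dimension 2 and 3. *)
Definition point n := {U : {vspace 'rV[F]_n} | \dim U == 1%N}.

Definition collinear n (P Q R : point n) : bool :=
  [exists L : {vspace 'rV[F]_n},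
    [&& \dim L == 2%N, (val P <= L)%VS, (val Q <= L)%VS & (val R <= L)%VS]].

Definition is_cap n (K : {set point n}) : bool :=
  [forall P in K, forall Q in K, forall R in K,
    uniq [:: P; Q; R] ==> ~~ collinear P Q R].

Definition complete_cap n (K : {set point n}) : bool := maxset (@is_cap n) K.

(* A projectivity is given by an invertible matrix g acting on row vectors on
   the right. *)
Definition proj_image n (g : 'M[F]_n) (S : {set point n}) : {set point n} :=
  [set P : point n | [exists Q in S,
    val P == (linfun (mulmxr g : 'rV_n -> 'rV_n) @: val Q)%VS]].

Definition veronese_vec (x : 'rV[F]_3) : 'rV[F]_6 :=
  \row_(i < 6) [:: x 0 0 ^+ 2; x 0 1 ^+ 2; x 0 2 ^+ 2;
                   x 0 0 * x 0 1; x 0 0 * x 0 2; x 0 1 * x 0 2]`_i.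

Definition sym_mx (v : 'rV[F]_6) : 'M[F]_3 :=
  \matrix_(i < 3, j < 3)
    (nth [::] [:: [:: v 0 0; v 0 3; v 0 4];
                  [:: v 0 3; v 0 1; v 0 5];
                  [:: v 0 4; v 0 5; v 0 2]] i)`_j.

Lemma sym_mx_veronese (x : 'rV[F]_3) : sym_mx (veronese_vec x) = x^T *m x.
Proof.
apply/matrixP=> i j; rewrite !mxE big_ord1 !mxE.
have ord3 (k : 'I_3) : [\/ k = 0, k = 1 | k = 2].
  by case: k => [[|[|[|k]]] //= lt_k3];
    [apply: Or31 | apply: Or32 | apply: Or33]; apply: val_inj.
by case: (ord3 i) => ->; case: (ord3 j) => -> /=; rewrite ?expr2 // mulrC.
Qed.

(* The Veronese image of the projective subspace U of PG(2,q). *)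
Definition std_veronese_on (U : {vspace 'rV[F]_3}) : {set point 6} :=
  [set P : point 6 | [exists x : 'rV[F]_3,
    [&& x != 0, x \in U & val P == <[veronese_vec x]>%VS]]].

Definition std_chordal : {set point 6} :=
  [set P : point 6 | [exists v : 'rV[F]_6,
    [&& v != 0, \det (sym_mx v) == 0 & val P == <[v]>%VS]]].

Definition veronese (g : 'M[F]_6) : {set point 6} :=
  proj_image g (std_veronese_on fullv).

Definition chordal (g : 'M[F]_6) : {set point 6} := proj_image g std_chordal.

(* The conics of the Veronese surface are the images of the lines of PG(2,q). *)
Definition conic (g : 'M[F]_6) (l : {vspace 'rV[F]_3}) : {set point 6} :=
  proj_image g (std_veronese_on l).

Definition conic_plane (C : {set point 6}) : {vspace 'rV[F]_6} :=
  (\sum_(P in C) val P)%VS.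

Definition tangent_line (C : {set point 6}) (L : {vspace 'rV[F]_6}) : bool :=
  [&& \dim L == 2%N, (L <= conic_plane C)%VS
    & #|[set P in C | (val P <= L)%VS]| == 1%N].

Definition is_nucleus (C : {set point 6}) (N : point 6) : Prop :=
  (val N <= conic_plane C)%VS /\
  forall L : {vspace 'rV[F]_6}, tangent_line C L -> (val N <= L)%VS.

Definition is_nuclear_plane (g : 'M[F]_6) (pi : {vspace 'rV[F]_6}) : Prop :=
  \dim pi = 3%N /\
  forall l : {vspace 'rV[F]_3}, \dim l = 2%N ->
  forall N : point 6, is_nucleus (conic g l) N -> (val N <= pi)%VS.

End ProjectiveSpace.

(* Main.v *)
(* The vectors [c *: nu x] form a cone of exactly q^3 vectors.  The assumption on
   the chordal varieties implies that a vector [a *: nu x + b *: nu y] of the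
   first surface equals one of the second only if both vanish: for q odd this is
   disjointness, and for q even a nonzero such vector never lies in the nuclear
   plane.  Hence the sum map from the product of the two cones to F^6 is
   injective, and bijective since both sides have q^6 elements, so every point
   outside the two surfaces lies on a line joining one to the other.  The same
   fact excludes a collinear triple that meets both surfaces. *)
Require Import Defs.
From HB Require Import structures.
From mathcomp Require Import all_boot all_order all_algebra all_field ring.

Set Implicit Arguments.
Unset Strict Implicit.
Unset Printing Implicit Defensive.

Import GRing.Theory.
Local Open Scope ring_scope.

(** * Veronese vectors as rank-one symmetric matrices *)

Section VeroneseVectors.

Variable F : finFieldType.

Local Notation nu := (@veronese_vec F).

Lemma sym_mx_is_linear : linear (@sym_mx F).
Proof.
move=> a u v; apply/matrixP=> i j; rewrite !mxE.
by case: i => [[|[|[|i]]] //= _]; case: j => [[|[|[|j]]] //= _]; rewrite !mxE.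
Qed.

HB.instance Definition _ :=
  GRing.isLinear.Build F 'rV[F]_6 'M[F]_3 *:%R (@sym_mx F) sym_mx_is_linear.

(** This lets identities between Veronese vectors be checked on the matrices [x^T *m x]. *)
Lemma sym_mx_inj : injective (@sym_mx F).
Proof.
move=> u v eq_uv; apply/rowP=> i.
have e j k : sym_mx u j k = sym_mx v j k by rewrite eq_uv.
pose i2 : 'I_3 := inord 2.
have := (e 0 0, e 0 1, e 0 i2, e 1 1, e 1 i2, e i2 i2).
rewrite !mxE !inordK //= => -[[[[[e0 e3] e4] e1] e5] e2].
have ord6 (k : 'I_6) : k \in [:: 0; 1; 2; 3; 4; 5].
  by case: k => [[|[|[|[|[|[|k]]]]]] //= ltk]; rewrite !inE -!val_eqE.
have := ord6 i; rewrite !inE.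
by do 5?[case/predU1P=> [-> //|]]; move/eqP->.
Qed.

Lemma veroneseZ c x : nu (c *: x) = c ^+ 2 *: nu x.
Proof.
apply: sym_mx_inj; rewrite linearZ /= !sym_mx_veronese [_^T]linearZ /=.
by rewrite -scalemxAl -scalemxAr scalerA.
Qed.

(** [nu] is quadratic, and the bracket is its polar form; in characteristic 2 it will give the
    nucleus of the conic over the line through x and y. *)
Lemma veronese_lin (a b : F) (x y : 'rV[F]_3) :
  nu (a *: x + b *: y) = a ^+ 2 *: nu x + b ^+ 2 *: nu y
     + (a * b) *: (nu (x + y) - nu x - nu y).
Proof.
apply: sym_mx_inj; rewrite !(linearD, linearZ, linearN) /= !sym_mx_veronese.
apply/matrixP=> i j; rewrite !mxE !big_ord1 !mxE; ring.
Qed.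

Lemma veronese0 : nu 0 = 0.
Proof. by rewrite -(scale0r 0) veroneseZ expr0n scale0r. Qed.

(** Compare the columns at an index j with [u 0 j != 0]: one is a nonzero multiple of x, the other a
    multiple of z. *)
Lemma outer_collinear m n (x z : 'rV[F]_m) (u v : 'rV[F]_n) :
  u != 0 -> x^T *m u = z^T *m v -> exists c, x = c *: z.
Proof.
move=> u_neq0 e.
have [j uj] : exists j, u 0 j != 0.
  apply/existsP; apply: contraNT u_neq0; rewrite negb_exists => /forallP u0.
  by apply/eqP/rowP=> j; rewrite mxE; apply/eqP; move: (u0 j); rewrite negbK.
exists (v 0 j / u 0 j); apply/rowP=> i; rewrite mxE.
have /matrixP/(_ i j) := e; rewrite !mxE !big_ord1 !mxE => eij.
by rewrite mulrAC [v 0 j * _]mulrC -eij mulfK.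
Qed.

Lemma veronese_eq0 x : (nu x == 0) = (x == 0).
Proof.
apply/eqP/eqP => [nx0|->]; last exact: veronese0.
apply/eqP/contraT => x_neq0.
(* With z = 0 the conclusion makes x a multiple of 0. *)
have [//||c def_x] := @outer_collinear 3 3 x 0 x 0.
  by rewrite -sym_mx_veronese nx0 linear0 trmx0 mul0mx.
by rewrite def_x scaler0 eqxx in x_neq0.
Qed.

Lemma veronese_scale_eq c x y :
  x != 0 -> nu x = c *: nu y -> exists d, x = d *: y.
Proof.
move=> x_neq0 e; apply: (@outer_collinear 3 3 x y x (c *: y)) => //.
by rewrite -sym_mx_veronese e linearZ /= sym_mx_veronese scalemxAr.
Qed.

(* Contracting with a functional that kills x but not y turns the relation into
   y^T (y u) ~ z^T (z u), so that y and z are proportional. *)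
Lemma veronese_three a b c x y z :
  b != 0 -> a *: nu x + b *: nu y + c *: nu z = 0 ->
  (y <= x)%MS \/ (y <= z)%MS.
Proof.
move=> b_neq0 e.
case: (boolP (y <= x)%MS) => [|yx]; [by left|right].
set U := cokermx x; rewrite submxE -/U in yx.
suff [d ->] : exists d, y = d *: z by exact: scalemx_sub.
apply: (@outer_collinear 3 3 y z (b *: (y *m U)) (- c *: (z *m U))).
  by rewrite scaler_eq0 negb_or b_neq0.
have := congr1 (fun w => sym_mx w *m U) e.
rewrite !(linearD, linearZ) /= !sym_mx_veronese linear0 mul0mx !mulmxDl.
rewrite -!scalemxAl -!mulmxA mulmx_coker mulmx0 scaler0 add0r => /eqP.
by rewrite addr_eq0 scaleNr => /eqP.
Qed.

(** The matrix factors as a 3 x 2 by a 2 x 3 matrix, so its rank is at most 2. *)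
Lemma det_chord a b x y : \det (sym_mx (a *: nu x + b *: nu y)) = 0.
Proof.
rewrite !(linearD, linearZ) /= !sym_mx_veronese !scalemxAl -mul_row_col.
set M := _ *m _; apply/eqP; rewrite -[_ == 0]negbK -unitfE -unitmxE.
by rewrite -row_free_unit /row_free neq_ltn ltnS mulmx_max_rank.
Qed.

(** * A parametrization of the cone over the Veronese surface *)

Definition pivot (x : 'rV[F]_3) : F :=
  if x 0 0 != 0 then x 0 0 else if x 0 1 != 0 then x 0 1 else x 0 2.

Lemma pivotZ c x : pivot (c *: x) = c * pivot x.
Proof.
rewrite /pivot !mxE; have [->|c_neq0] := eqVneq c 0.
  by rewrite !mul0r !eqxx.
by rewrite !mulf_eq0 (negPf c_neq0) /=; do 2?case: ifP.
Qed.

Lemma pivot_neq0 x : x != 0 -> pivot x != 0.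
Proof.
apply: contraNneq; rewrite /pivot => p0.
have [x0 x1 x2] : [/\ x 0 0 = 0, x 0 1 = 0 & x 0 2 = 0].
  move: p0; case: ifP => [/eqP //|/negbFE/eqP ->].
  by case: ifP => [/eqP //|/negbFE/eqP ->].
apply/eqP/rowP => i; rewrite mxE.
have ord3 (k : 'I_3) : k \in [:: 0; 1; 2].
  by case: k => [[|[|[|k]]] //= ltk]; rewrite !inE -!val_eqE.
have := ord3 i; rewrite !inE.
by do 2?[case/predU1P=> [-> //|]]; move/eqP->.
Qed.

(* Normalized to be homogeneous of degree 1, which is what makes it injective on
   vectors rather than only on points. *)
Definition cone_vec x := (pivot x)^-1 *: nu x.

(** Equal nonzero values force x = c y, and homogeneity of degree 1 then gives c = 1. The zero
    vector is treated apart: it alone is sent to 0. *)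
Lemma cone_vec_inj : injective cone_vec.
Proof.
move=> x y.
have [->|x_neq0] := eqVneq x 0.
  rewrite {1}/cone_vec veronese0 scaler0 => /esym/eqP.
  rewrite scaler_eq0 veronese_eq0 invr_eq0.
  by case: (eqVneq y 0) => [-> //|/pivot_neq0/negPf->].
move=> e.
have [||c def_x] := @veronese_scale_eq (pivot x / pivot y) x y => //.
  by rewrite -scalerA -/(cone_vec y) -e scalerA mulfV ?scale1r ?pivot_neq0.
move: x_neq0 e; rewrite {x}def_x scaler_eq0 negb_or => /andP[c0 y0].
rewrite /cone_vec pivotZ veroneseZ scalerA => /eqP; rewrite -subr_eq0 -scalerBl.
rewrite scaler_eq0 veronese_eq0 (negPf y0) orbF subr_eq0 expr2 invfM mulrAC.
rewrite mulrA mulVf // mul1r -{2}[(pivot y)^-1]mul1r => /eqP/mulIf -> //.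
  by rewrite scale1r.
by rewrite invr_eq0 pivot_neq0.
Qed.

End VeroneseVectors.

(** * Points, their spanning vectors, and collinearity *)

Section Points.

Variable F : finFieldType.

Local Notation nu := (@veronese_vec F).

Lemma pointE n (P : point F n) : exists2 v, v != 0 & val P = <[v]>%VS.
Proof.
case: P => U /= dimU; exists (vpick U).
  by rewrite vpick0 -dimv_eq0 (eqP dimU).
apply/esym/eqP; rewrite eqEdim (eqP dimU) dim_vline vpick0 -dimv_eq0 (eqP dimU).
by rewrite -memvE memv_pick.
Qed.

Lemma point_of n (v : 'rV[F]_n) : v != 0 -> exists P : point F n, val P = <[v]>%VS.
Proof.
move=> v_neq0; have dimv : \dim <[v]> == 1%N by rewrite dim_vline v_neq0.
by exists (exist (fun U : {vspace _} => \dim U == 1%N) _ dimv).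
Qed.

Lemma vline_scale n c (v : 'rV[F]_n) : c *: v != 0 -> <[c *: v]>%VS = <[v]>%VS.
Proof.
move=> cv_neq0; apply/eqP; rewrite eqEdim -memvE memvZ ?memv_line //=.
by rewrite !dim_vline cv_neq0; case: (v != 0).
Qed.

Lemma limg_mulmxr n (g : 'M[F]_n) (v : 'rV_n) :
  (linfun (mulmxr g : 'rV_n -> 'rV_n) @: <[v]>)%VS = <[v *m g]>%VS.
Proof. by rewrite limg_line lfunE. Qed.

Lemma mulmx_unit_eq0 n (g : 'M[F]_n) (v : 'rV_n) :
  g \in unitmx -> (v *m g == 0) = (v == 0).
Proof.
move=> gU; apply/eqP/eqP => [vg0|->]; last by rewrite mul0mx.
by rewrite -(mulmxK gU v) vg0 mul0mx.
Qed.

Lemma conicP (g : 'M[F]_6) (l : {vspace 'rV[F]_3}) (P : point F 6) :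
  reflect (exists x, [/\ x != 0, x \in l & val P = <[nu x *m g]>%VS])
    (P \in conic g l).
Proof.
rewrite inE; apply: (iffP existsP) => [[Q /andP[]]|[x [x0 xl Px]]].
  rewrite inE => /existsP[x /and3P[x0 xl /eqP Qx]] /eqP; rewrite Qx limg_mulmxr.
  by exists x.
have [|Q Qx] := @point_of 6 (nu x); first by rewrite veronese_eq0.
exists Q; rewrite Qx limg_mulmxr Px eqxx andbT.
by rewrite inE; apply/existsP; exists x; rewrite x0 xl Qx eqxx.
Qed.

Lemma veroneseP (g : 'M[F]_6) (P : point F 6) :
  reflect (exists2 x, x != 0 & val P = <[nu x *m g]>%VS) (P \in veronese g).
Proof.
apply: (iffP (@conicP g fullv P)) => [[x [x0 _ Px]]|[x x0 Px]]; exists x => //.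
by rewrite memvf.
Qed.

Lemma veronese_mem (g : 'M[F]_6) a x (P : point F 6) :
    g \in unitmx -> a *: nu x != 0 -> val P = <[(a *: nu x) *m g]>%VS ->
  P \in veronese g.
Proof.
move=> gU ax0 Pax; apply/veroneseP; exists x.
  by apply: contraNneq ax0 => ->; rewrite veronese0 scaler0.
by rewrite Pax -scalemxAl vline_scale // scalemxAl mulmx_unit_eq0.
Qed.

Lemma chordal_mem (g : 'M[F]_6) w (P : point F 6) :
    w != 0 -> \det (sym_mx w) = 0 -> val P = <[w *m g]>%VS ->
  P \in chordal g.
Proof.
move=> w0 detw Pw; have [Q Qw] := point_of w0.
rewrite inE; apply/existsP; exists Q; rewrite Qw limg_mulmxr Pw eqxx andbT.
by rewrite inE; apply/existsP; exists w; rewrite w0 detw Qw !eqxx.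
Qed.

Lemma dim_add_points n (P Q : point F n) :
  P != Q -> \dim (val P + val Q)%VS = 2.
Proof.
move=> PQ; have dimP (R : point F n) : \dim (val R) = 1 by apply/eqP/(valP R).
have le2 : (\dim (val P + val Q)%VS <= 2)%N.
  by rewrite (leq_trans (dimv_add_leqif _ _)) // !dimP.
apply/eqP; rewrite eqn_leq le2 ltnNge; apply: contra PQ => dim1.
have sub1 (R : point F n) : (val R <= val P + val Q)%VS ->
    val R = (val P + val Q)%VS.
  by move=> sR; apply/eqP; rewrite eqEdim sR dimP.
by apply/eqP/val_inj; rewrite (sub1 P) ?addvSl // -(sub1 Q) ?addvSr.
Qed.

Lemma collinear_add n (P Q R : point F n) p q :
    val P = <[p]>%VS -> val Q = <[q]>%VS -> val R = <[p + q]>%VS ->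
  P != Q -> collinear P Q R.
Proof.
move=> Pp Qq Rpq PQ; apply/existsP; exists (val P + val Q)%VS.
rewrite dim_add_points // addvSl addvSr Rpq -memvE Pp Qq.
by rewrite memv_add ?memv_line.
Qed.

(** R lies in the span of P and Q, so r = a p + b q; a zero coefficient would identify R with P or
    Q. *)
Lemma collinear_rel n (P Q R : point F n) p q r :
    val P = <[p]>%VS -> val Q = <[q]>%VS -> val R = <[r]>%VS ->
    uniq [:: P; Q; R] -> collinear P Q R ->
  exists a b c, [/\ a != 0, b != 0, c != 0 & a *: p + b *: q + c *: r = 0].
Proof.
move=> Pp Qq Rr PQR /existsP[L /and4P[/eqP dimL PL QL RL]].
move: PQR; rewrite /= !inE negb_or andbT => /andP[/andP[PQ PR] QR].
have defL : (val P + val Q)%VS = L.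
  by apply/eqP; rewrite eqEdim dim_add_points // dimL subv_add PL QL.
have r0 : r != 0.
  by have := valP R; rewrite /= Rr dim_vline; case: (r == 0).
move: RL; rewrite -defL Rr Pp Qq -memvE.
case/memv_addP => _ /vlineP[a ->] [_ /vlineP[b ->] def_r].
exists a, b, (-1); split.
- apply: contraNneq QR => a0; apply/eqP/val_inj; rewrite Rr Qq.
  by move: r0; rewrite def_r a0 scale0r add0r => /vline_scale ->.
- apply: contraNneq PR => b0; apply/eqP/val_inj; rewrite Rr Pp.
  by move: r0; rewrite def_r b0 scale0r addr0 => /vline_scale ->.
- by rewrite oppr_eq0 oner_eq0.
by rewrite scaleN1r def_r subrr.
Qed.

(** * Nuclei of conics and the nuclear plane in characteristic 2 *)

(* The polynomial [Q] cuts out the conic on the lines of its plane that miss the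
   nucleus; its polar form is [s t' + s' t], which in characteristic 2 is the
   determinant of [(s, t), (s', t')], so that from a root (s, t) of [Q] and any
   other vector one obtains a second root. *)
Lemma polar_nucleus (g : 'M[F]_6) (a b : 'rV[F]_3) (N : point F 6) :
    g \in unitmx -> (1 + 1 = 0 :> F) ->
    (forall s t, s *: a + t *: b = 0 -> s = 0 /\ t = 0) ->
    val N = <[(nu (a + b) - nu a - nu b) *m g]>%VS ->
  is_nucleus (conic g (<[a]> + <[b]>)) N.
Proof.
move=> gU char2 free_ab; set p := nu (a + b) - nu a - nu b => Np.
set C := conic g _.
have nonzero s t : (s != 0) || (t != 0) -> s *: a + t *: b != 0.
  by apply: contraTneq => /free_ab[-> ->]; rewrite eqxx.
have in_l s t : s *: a + t *: b \in (<[a]> + <[b]>)%VS.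
  by rewrite memv_add ?memvZ ?memv_line.
have C_pt s t : (s != 0) || (t != 0) ->
    exists2 P, P \in C & val P = <[nu (s *: a + t *: b) *m g]>%VS.
  move=> st0; have [|P Pv] := @point_of 6 (nu (s *: a + t *: b) *m g).
    by rewrite mulmx_unit_eq0 // veronese_eq0 nonzero.
  by exists P => //; apply/conicP; exists (s *: a + t *: b); rewrite nonzero.
have C_plane s t : nu (s *: a + t *: b) *m g \in conic_plane C.
  have [/C_pt[P PC Pv]|] := boolP ((s != 0) || (t != 0)).
    by rewrite memvE -Pv; apply: sumv_sup PC _.
  rewrite negb_or !negbK => /andP[/eqP-> /eqP->].
  by rewrite !scale0r addr0 veronese0 mul0mx mem0v.
split=> [|L /and3P[/eqP dimL LC /cards1P[P0 defP0]]].
  (* The polar vector is a combination of the conic points over a + b, a and b. *)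
  rewrite Np -memvE !mulmxBl.
  have := (C_plane 1 1, C_plane 1 0, C_plane 0 1).
  by rewrite !scale1r !scale0r addr0 add0r => -[[h1 h2] h3]; rewrite !memvB.
apply/contraT; rewrite Np -memvE => pL.
pose W := (<[nu a *m g]> + <[nu b *m g]> + <[p *m g]>)%VS.
have nuE s t : nu (s *: a + t *: b) *m g =
    s ^+ 2 *: (nu a *m g) + t ^+ 2 *: (nu b *m g) + (s * t) *: (p *m g).
  by rewrite veronese_lin -/p; move: (p) => r; rewrite !mulmxDl !scalemxAl.
have CW : (conic_plane C <= W)%VS.
  apply/subv_sumP=> P /conicP[x [_ /memv_addP[_ /vlineP[s ->]]]].
  case=> _ /vlineP[t ->] -> ->; rewrite -memvE nuE.
  by rewrite !memv_add ?memvZ ?memv_line.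
(* If the tangent L misses N, adding N raises its dimension to 3, which is the most that W can
   have. *)
have defW : (L + <[p *m g]>)%VS = W.
  apply/eqP; rewrite eqEdim subv_add (subv_trans LC CW) addvSr /=.
  apply: (@leq_trans 3).
    apply: leq_trans (dimv_add_leqif _ _) _; rewrite -[3%N]/(2 + 1)%N.
    apply: leq_add; last by rewrite dim_vline leq_b1.
    apply: leq_trans (dimv_add_leqif _ _) _; rewrite -[2%N]/(1 + 1)%N.
    by apply: leq_add; rewrite dim_vline leq_b1.
  apply: (@leq_ltn_trans (\dim L)); first by rewrite dimL.
  rewrite (ltn_leqif (dimv_leqif_eq (addvSl _ _))).
  by apply: contra pL => /eqP ->; rewrite memvE addvSr.
have decomp v : v \in W -> exists2 u, u \in L & exists c, v = u + c *: (p *m g).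
  rewrite -defW => /memv_addP[u uL [_ /vlineP[c ->] ->]].
  by exists u => //; exists c.
have [|ua uaL [la def_a]] := decomp (nu a *m g).
  by rewrite memvE /W -addvA addvSl.
have [|ub ubL [mu def_b]] := decomp (nu b *m g).
  by rewrite memvE /W [(<[nu a *m g]> + _)%VS]addvC -addvA addvSl.
(* Modulo L, the vectors over a and b are [la] and [mu] times the polar vector, so the vector over s
   a + t b is [Q s t] times it. *)
pose Q s t := s ^+ 2 * la + t ^+ 2 * mu + s * t.
have inL s t : (nu (s *: a + t *: b) *m g \in L) = (Q s t == 0).
  have -> : nu (s *: a + t *: b) *m g =
      (s ^+ 2 *: ua + t ^+ 2 *: ub) + Q s t *: (p *m g).
    rewrite nuE def_a def_b /Q !scalerDr !scalerDl !scalerA.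
    by rewrite -!addrA; congr (_ + _); rewrite addrCA.
  by rewrite rpredDl ?rpredZeq ?(negPf pL) ?orbF // memvD ?memvZ.
have: P0 \in [set P in C | (val P <= L)%VS] by rewrite defP0 set11.
rewrite inE => /andP[/conicP[x [x0 /memv_addP[_ /vlineP[s ->]]]]].
case=> _ /vlineP[t ->] def_x P0x; rewrite P0x -memvE def_x inL => /eqP Qst.
have [y1 [y2 det_y]] : exists y1 y2, s * y2 + t * y1 != 0.
  have [t0|t0] := eqVneq t 0; last by exists 1, 0; rewrite mulr0 add0r mulr1.
  exists 0, 1; rewrite mulr1 mulr0 addr0; apply: contraNneq x0 => s0.
  by rewrite def_x s0 t0 !scale0r addr0.
(* Up to the factor Q(y), this is the reflection of the root (s, t) along y; it is y scaled by D
   when Q(y) = 0. *)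
pose D := s * y2 + t * y1; pose s' := Q y1 y2 * s + D * y1.
pose t' := Q y1 y2 * t + D * y2.
have det_st' : s * t' + t * s' = D ^+ 2.
  have -> : s * t' + t * s' = D ^+ 2 + (1 + 1) * (s * t * Q y1 y2).
    by rewrite /s' /t' /D; ring.
  by rewrite char2 mul0r addr0.
have Qst' : Q s' t' = 0.
  have -> : Q s' t' = Q y1 y2 ^+ 2 * Q s t + (1 + 1) * (D * Q y1 y2 *
      (s * y1 * la + t * y2 * mu + D)).
    by rewrite /s' /t' /D /Q; ring.
  by rewrite Qst char2 mulr0 mul0r addr0.
have st'0 : (s' != 0) || (t' != 0).
  apply: contraNT det_y; rewrite negb_or !negbK => /andP[/eqP s'0 /eqP t'0].
  by rewrite -/D -sqrf_eq0 -det_st' s'0 t'0 !mulr0 addr0.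
have [P' P'C P'v] := C_pt _ _ st'0.
have: P' \in [set P in C | (val P <= L)%VS].
  by rewrite inE P'C P'v -memvE inL Qst' eqxx.
(* By tangency the second root gives the same point, so it is d (s, t); then [det_st'] makes D ^+ 2
   equal to 2 s t d = 0. *)
rewrite defP0 inE => /eqP eqP'; move: P'v; rewrite eqP' P0x def_x => eq_x.
have /vlineP[c] : nu (s' *: a + t' *: b) *m g \in
    <[nu (s *: a + t *: b) *m g]>%VS by rewrite eq_x memv_line.
rewrite scalemxAl => /(can_inj (mulmxK gU)).
case/(veronese_scale_eq (nonzero _ _ st'0)) => d /eqP.
rewrite -subr_eq0 scalerDr !scalerA opprD addrACA -!scalerBl => /eqP/free_ab.
case=> /subr0_eq s'E /subr0_eq t'E; move: det_y; rewrite -/D -sqrf_eq0 -det_st'.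
rewrite s'E t'E (_ : _ + _ = (1 + 1) * (s * t * d)); last by ring.
by rewrite char2 mul0r eqxx.
Qed.

(** The last three coordinates are the mixed products, so the polar vectors of the three coordinate
    lines are the last three unit vectors. *)
Lemma delta_polar (i : 'I_3) : exists j k : 'I_3, j != k /\
  (delta_mx 0 (rshift 3 i) : 'rV[F]_6) =
    nu (delta_mx 0 j + delta_mx 0 k) - nu (delta_mx 0 j) - nu (delta_mx 0 k).
Proof.
case: i => [[|[|[|i]]] //= lti];
  [exists 0, 1 | exists 0, (inord 2) | exists 1, (inord 2)]; split;
  rewrite -?val_eqE /= ?inordK //; apply/rowP;
  case=> [[|[|[|[|[|[|m]]]]]] //= ltm];
  rewrite !mxE -?val_eqE /= ?inordK // ?eqxx /=; ring.
Qed.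

(** The nuclei of the three coordinate conics already span a space of dimension 3, so it is all of
    [pi]; before applying g it consists of the vectors whose matrix has zero diagonal. *)
Lemma nuclear_plane_diag0 (g : 'M[F]_6) (pi : {vspace 'rV[F]_6}) (w : 'rV[F]_6) :
    g \in unitmx -> (1 + 1 = 0 :> F) -> is_nuclear_plane g pi ->
    w *m g \in pi -> forall i : 'I_3, w 0 (lshift 3 i) = 0.
Proof.
move=> gU char2 [dim_pi pi_nuc] wpi.
pose X := [tuple (delta_mx 0 (rshift 3 i) : 'rV[F]_6) *m g | i < 3].
have XE (i : 'I_3) : X`_i = (delta_mx 0 (rshift 3 i) : 'rV[F]_6) *m g.
  by rewrite (nth_map i) ?size_enum_ord // nth_ord_enum.
have sumX (k : 'I_3 -> F) :
    \sum_i k i *: X`_i = (\sum_i k i *: delta_mx 0 (rshift 3 i) : 'rV[F]_6) *m g.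
  by rewrite mulmx_suml; apply: eq_bigr => i _; rewrite XE scalemxAl.
have freeX : free X.
  apply/freeP => k; rewrite sumX => /eqP; rewrite mulmx_unit_eq0 // => /eqP e i.
  have := congr1 (fun v : 'rV_(3 + 3) => v 0 (rshift 3 i)) e.
  rewrite summxE (bigD1 i) //= big1 => [|j ji].
    by rewrite !mxE !eqxx mulr1 addr0.
  by rewrite !mxE eqxx (inj_eq (@rshift_inj 3 3)) eq_sym (negPf ji) mulr0.
have polar_pi (i j : 'I_3) : i != j ->
    (nu (delta_mx 0 i + delta_mx 0 j) - nu (delta_mx 0 i) - nu (delta_mx 0 j))
      *m g \in pi.
  move=> ij; set a := delta_mx 0 i; set b := delta_mx 0 j; set p := _ *m g.
  have free_ab s t : s *: a + t *: b = 0 -> s = 0 /\ t = 0.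
    move=> /rowP e; move: (e i) (e j).
    rewrite !mxE !eqxx [j == i]eq_sym (negPf ij) /=.
    by rewrite !mulr0 !mulr1 addr0 add0r.
  have [->|p0] := eqVneq p 0; first exact: mem0v.
  have [N Np] := point_of p0; rewrite memvE -Np.
  apply: (pi_nuc (<[a]> + <[b]>)%VS); last exact: polar_nucleus.
  have [|A Aa] := @point_of 3 a.
    apply/eqP=> a0; have [|/eqP] := free_ab 1 0; last by rewrite oner_eq0.
    by rewrite a0 scaler0 scale0r addr0.
  have [|B Bb] := @point_of 3 b.
    apply/eqP=> b0; have [|_ /eqP] := free_ab 0 1; last by rewrite oner_eq0.
    by rewrite b0 scaler0 scale0r addr0.
  rewrite -Aa -Bb dim_add_points //; apply/eqP=> eqAB.
  have /vlineP[c ac] : a \in <[b]>%VS by rewrite -Bb -eqAB Aa memv_line.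
  have [|/eqP] := free_ab 1 (- c); last by rewrite oner_eq0.
  by rewrite scale1r scaleNr -ac subrr.
have Xpi : (<<X>> <= pi)%VS.
  apply/span_subvP => _ /mapP[i _ ->].
  have [j [k [jk ->]]] := delta_polar i; exact: polar_pi.
have defpi : <<X>>%VS = pi.
  by apply/eqP; rewrite eqEdim Xpi dim_pi (eqnP freeX) size_tuple.
move: wpi; rewrite -defpi => /coord_span; rewrite sumX.
move=> /(can_inj (mulmxK gU)) -> i; rewrite summxE big1 // => j _.
by rewrite !mxE eq_lrshift andbF mulr0.
Qed.

(** Squaring is injective in characteristic 2, hence bijective on a finite field. *)
Lemma char2_sqrt : (1 + 1 = 0 :> F) -> forall a : F, exists b, a = b ^+ 2.
Proof.
move=> char2 a; have sqr_inj : injective (fun b : F => b ^+ 2).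
  move=> x y /eqP; rewrite eqf_sqr => /orP[/eqP //|/eqP ->].
  by apply/eqP; rewrite -subr_eq0 -opprD oppr_eq0 -[y]mul1r -mulrDl char2 mul0r.
by have [f _ fK] := injF_bij sqr_inj; exists (f a); rewrite fK.
Qed.

(* Over a field of characteristic 2 every coefficient is a square, so the chord
   vector is [nu x' + nu y'] and has diagonal [(x'_i + y'_i) ^ 2]. *)
Lemma chord_nuclear (g : 'M[F]_6) (pi : {vspace 'rV[F]_6}) a b x y :
    g \in unitmx -> (1 + 1 = 0 :> F) -> is_nuclear_plane g pi ->
    (a *: nu x + b *: nu y) *m g \in pi -> a *: nu x + b *: nu y = 0.
Proof.
move=> gU char2 pi_nuc /(nuclear_plane_diag0 gU char2 pi_nuc).
have [[s ->] [t ->]] := (char2_sqrt char2 a, char2_sqrt char2 b).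
rewrite -!veroneseZ; move: (s *: x) (t *: y) => {s t}x {}y diag0.
have opp (c : F) : - c = c.
  by apply/eqP; rewrite eq_sym -subr_eq0 opprK -[c]mul1r -mulrDl char2 mul0r.
(* The diagonal entries are squares of x_i + y_i = x_i - y_i; once x = y, the chord vector is 2 [nu]
   x = 0. *)
have -> : x = y.
  apply/rowP => i; apply/eqP; rewrite -subr_eq0 opp -sqrf_eq0 sqrrD.
  rewrite -mulr_natl mulr2n char2 mul0r addr0.
  rewrite -(diag0 i) !mxE.
  by case: i => [[|[|[|i]]] //= lti]; apply/eqP; congr (_ ^+ 2 + _ ^+ 2);
    congr (_ 0 _); apply: val_inj.
by apply/rowP=> i; rewrite !mxE -[X in X + _]opp addNr.
Qed.

(** * Independence of the chords of the two surfaces *)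

(** A vector form of the hypothesis common to both parities. Zero coefficients are allowed, so it
    also covers single points of the surfaces. *)
Definition chords_independent (g g' : 'M[F]_6) :=
  forall a b c d x y z w,
    (a *: nu x + b *: nu y) *m g = (c *: nu z + d *: nu w) *m g' ->
  a *: nu x + b *: nu y = 0 /\ c *: nu z + d *: nu w = 0.

Lemma chords_independentC g g' :
  chords_independent g g' -> chords_independent g' g.
Proof. by move=> ind a b c d x y z w /esym/ind[]. Qed.

Lemma char2_even : ~~ odd #|F| -> 1 + 1 = 0 :> F.
Proof.
move=> evenF; have [p p_pr pF] := finPcharP F.
have := card_pprimeChar pF; rewrite -[#|_|]/#|F| => cardF.
move: evenF; rewrite cardF oddX negb_or => /andP[_ /negP p_odd].
have p2 : p = 2 by case: (even_prime p_pr) => // /p_odd.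
by apply/eqP; rewrite -[1 + 1]/(2%:R) -(dvdn_pcharf pF) p2.
Qed.

Lemma chords_independentP (g g' : 'M[F]_6) :
    g \in unitmx -> g' \in unitmx ->
    (odd #|F| -> [disjoint chordal g & chordal g']) ->
    (~~ odd #|F| ->
     exists pi : {vspace 'rV[F]_6},
       [/\ is_nuclear_plane g pi, is_nuclear_plane g' pi
         & forall P : point F 6,
             P \in chordal g -> P \in chordal g' -> (val P <= pi)%VS]) ->
  chords_independent g g'.
Proof.
move=> gU g'U hodd heven a b c d x y z w.
set u := _ + _ => e; set v := _ + _ in e *.
suff u0 : u = 0.
  split=> //; apply/eqP; rewrite -(mulmx_unit_eq0 _ g'U).
  by rewrite -e u0 mul0mx.
apply/eqP/contraT => u_neq0.
have v_neq0 : v != 0.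
  by rewrite -(mulmx_unit_eq0 _ g'U) -e mulmx_unit_eq0.
have [|P Pu] := @point_of 6 (u *m g); first by rewrite mulmx_unit_eq0.
have Pg : P \in chordal g by apply: chordal_mem Pu => //; apply: det_chord.
have Pg' : P \in chordal g'.
  by apply: (@chordal_mem _ v) => //; [apply: det_chord | rewrite -e].
have [/hodd disj|/[dup] evenF /heven[pi [pi_g _ /(_ P Pg Pg')]]] :=
    boolP (odd #|F|); first by rewrite (disjointFr disj Pg) in Pg'.
rewrite Pu -memvE => /(chord_nuclear gU (char2_even evenF) pi_g) u0.
by move: u_neq0; rewrite /u u0 eqxx.
Qed.

(** * Spanning by the two cones, and the cap property *)

Lemma veronese_union_span (g g' : 'M[F]_6) (v : 'rV[F]_6) :
    g \in unitmx -> g' \in unitmx -> chords_independent g g' ->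
  exists a b x y, v = (a *: nu x) *m g + (b *: nu y) *m g'.
Proof.
move=> gU g'U ind.
pose f (xy : 'rV[F]_3 * 'rV[F]_3) := cone_vec xy.1 *m g + cone_vec xy.2 *m g'.
have f_inj : injective f.
  (* Regrouping equates the difference of two cone vectors on one surface with such a difference on
     the other; both are chord vectors, so both vanish. *)
  move=> [x y] [z w] /= /eqP; rewrite -subr_eq0 opprD addrACA -!mulmxBl addr_eq0.
  rewrite -mulNmx opprB /cone_vec -!scaleNr => /eqP/ind[].
  rewrite !scaleNr => /subr0_eq exz /subr0_eq ewy.
  by move: (cone_vec_inj exz) (cone_vec_inj ewy) => /= -> ->.
have [|h _ hK] := inj_card_bij f_inj.
  by rewrite card_prod !card_mx -expnD.
rewrite -(hK v) /f /cone_vec.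
by exists (pivot (h v).1)^-1, (pivot (h v).2)^-1, (h v).1, (h v).2.
Qed.

(** If R is on the surface of P and Q, [veronese_three] makes Q equal to P or R. Otherwise the
    relation equates a chord vector of the first surface with a nonzero vector of the second. *)
Lemma veronese_not_collinear g g' (P Q R : point F 6) :
    g \in unitmx -> chords_independent g g' ->
    P \in veronese g -> Q \in veronese g -> R \in veronese g :|: veronese g' ->
  uniq [:: P; Q; R] -> ~~ collinear P Q R.
Proof.
move=> gU ind /veroneseP[x x0 Px] /veroneseP[y y0 Qy] RU PQR.
apply/negP=> collPQR.
have eq_pt z (S : point F 6) : val S = <[nu z *m g]>%VS -> (y <= z)%MS -> Q = S.
  move=> Sz /sub_rVP[d y_dz]; apply/val_inj; rewrite Qy Sz y_dz veroneseZ.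
  rewrite -scalemxAl vline_scale // scalemxAl -veroneseZ -y_dz.
  by rewrite mulmx_unit_eq0 // veronese_eq0.
move: RU => /setUP[] /veroneseP[z z0 Rz];
  have [a [b [c [a0 b0 c0]]]] := collinear_rel Px Qy Rz PQR collPQR.
- rewrite !scalemxAl -!mulmxDl => /eqP; rewrite mulmx_unit_eq0 // => /eqP.
  move: PQR; rewrite /= !inE negb_or andbT => /andP[/andP[PQ _] QR].
  case/(veronese_three b0) => [/(eq_pt _ _ Px) eqQ|/(eq_pt _ _ Rz) eqQ].
    by rewrite eqQ eqxx in PQ.
  by rewrite eqQ eqxx in QR.
- rewrite !scalemxAl -mulmxDl => /eqP; rewrite addr_eq0 -mulNmx -scaleNr.
  (* Padding with a zero multiple gives the single point the shape of a chord. *)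
  rewrite -[- c *: _]addr0 -(scale0r (nu z)) => /eqP/ind[_ /eqP].
  by rewrite scale0r addr0 scaler_eq0 oppr_eq0 (negPf c0) veronese_eq0 (negPf z0).
Qed.

Lemma collinear_rot n (P Q R : point F n) : collinear P Q R = collinear Q R P.
Proof. by apply: eq_existsb => L; rewrite andbA andbAC -!andbA. Qed.

(** By the pigeonhole principle two of the three points share a surface; a rotation puts them
    first. *)
Lemma veronese_union_cap g g' :
    g \in unitmx -> g' \in unitmx -> chords_independent g g' ->
  is_cap (veronese g :|: veronese g').
Proof.
move=> gU g'U ind; have ind' := chords_independentC ind.
apply/forall_inP=> P PK; apply/forall_inP=> Q QK; apply/forall_inP=> R RK.
apply/implyP=> PQR.
have same S T U : uniq [:: S; T; U] -> U \in veronese g :|: veronese g' ->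
    (S \in veronese g) && (T \in veronese g)
      || (S \in veronese g') && (T \in veronese g') -> ~~ collinear S T U.
  move=> STU UK /orP[] /andP[Sg Tg].
    exact: (veronese_not_collinear gU ind Sg Tg UK STU).
  rewrite setUC in UK.
  exact: (veronese_not_collinear g'U ind' Sg Tg UK STU).
have two_same (p p' q q' r r' : bool) : p || p' -> q || q' -> r || r' ->
    [|| p && q || p' && q', q && r || q' && r' | r && p || r' && p'].
  by case: p p' q q' r r' => [] [] [] [] [] [].
rewrite in_setU in PK; rewrite in_setU in QK; rewrite in_setU in RK.
case/or3P: (two_same _ _ _ _ _ _ PK QK RK) => same_surface.
- by apply: same PQR _ same_surface; rewrite in_setU.
- rewrite collinear_rot; apply: same same_surface; last by rewrite in_setU.
  by rewrite -(rot_uniq 2).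
rewrite -collinear_rot; apply: same same_surface; last by rewrite in_setU.
by rewrite -(rot_uniq 1).
Qed.

End Points.

(** * Completeness of the union *)

Theorem theorem4p8 (F : finFieldType) (g g' : 'M[F]_6)
  (hq : (2 < #|F|)%N)
  (hg : g \in unitmx) (hg' : g' \in unitmx)
  (hodd : odd #|F| -> [disjoint chordal g & chordal g'])
  (heven : ~~ odd #|F| ->
     exists pi : {vspace 'rV[F]_6},
       [/\ is_nuclear_plane g pi, is_nuclear_plane g' pi
         & forall P : point F 6,
             P \in chordal g -> P \in chordal g' -> (val P <= pi)%VS]) :
  complete_cap (veronese g :|: veronese g').
Proof.
have ind := chords_independentP hg hg' hodd heven.
apply/maxsetP; split=> [|B capB KB]; first exact: veronese_union_cap.
apply/eqP; rewrite eqEsubset KB andbT; apply/subsetP=> R RB.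
apply/contraT => RK; have [v v0 Rv] := pointE R.
have [a [b [x [y def_v]]]] := veronese_union_span v hg hg' ind.
move: RK; rewrite in_setU negb_or => /andP[Rg Rg'].
(* If one summand vanished, R would lie on the surface of the other. *)
have ax0 : a *: veronese_vec x != 0.
  apply: contraNneq Rg' => ax0; move: v0 Rv.
  rewrite def_v ax0 mul0mx add0r mulmx_unit_eq0 //; exact: veronese_mem.
have by0 : b *: veronese_vec y != 0.
  apply: contraNneq Rg => by0; move: v0 Rv.
  rewrite def_v by0 mul0mx addr0 mulmx_unit_eq0 //; exact: veronese_mem.
have [|P Px] := @point_of F 6 ((a *: veronese_vec x) *m g).
  by rewrite mulmx_unit_eq0.
have [|Q Qy] := @point_of F 6 ((b *: veronese_vec y) *m g').
  by rewrite mulmx_unit_eq0.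
have Pg : P \in veronese g by apply: veronese_mem Px.
have Qg' : Q \in veronese g' by apply: veronese_mem Qy.
(* Equal points would have proportional spanning vectors, against independence. *)
have PQ : P != Q.
  apply: contraNneq ax0 => eqPQ.
  have /vlineP[c] : (a *: veronese_vec x) *m g
      \in <[(b *: veronese_vec y) *m g']>%VS by rewrite -Qy -eqPQ Px memv_line.
  have := ind a 0 (c * b) 0 x 0 y 0; rewrite !scale0r !addr0 => ind_xy.
  by rewrite scalemxAl scalerA => /ind_xy[-> _].
have PB : P \in B by apply: (subsetP KB); rewrite in_setU Pg.
have QB : Q \in B by apply: (subsetP KB); rewrite in_setU Qg' orbT.
have PR : P != R by apply: contraNneq Rg => <-.
have QR : Q != R by apply: contraNneq Rg' => <-.
have := forall_inP (forall_inP (forall_inP capB P PB) Q QB) R RB.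
(* R is spanned by the sum of the vectors of P and Q, so the cap B would contain three distinct
   collinear points. *)
by rewrite (collinear_add Px Qy _ PQ) -?def_v // implybF /= !inE negb_or PQ PR QR.
Qed.
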